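(* Let $\mathcal{H}=\mathcal{H}_1\times\cdots\times\mathcal{H}_m$ be a product of Hilbert spaces and let $S:\mathcal{H}\to\mathcal{H}$ be an operator such that $I-S$ is nonexpansive and $\operatorname{zer}(S)\neq\emptyset$. Let $(x^k)_{k\ge 0}$ be generated by the Cyclic Coordinate Update algorithm from an arbitrary $x^0\in\mathcal{H}$, with an arbitrary ordering of the $m$ coordinates in each epoch, and with step sizes $$\alpha_k=\frac{1}{k^{1/2}},\qquad k=1,2,\ldots$$ Then $x^k$ converges weakly to some $x^*\in\operatorname{zer}(S)$.
   Context: $\mathcal{H}=\mathcal{H}_1\times\cdots\times\mathcal{H}_m$, where each $\mathcal{H}_i$ is a (real) Hilbert space, carries the product inner product $\langle\cdot,\cdot\rangle$ and the induced norm $\|\cdot\|$; $x=(x_1,\ldots,x_m)$ with $x_i\in\mathcal{H}_i$. $I$ is the identity. $I-S$ is nonexpansive means $\|(I-S)x-(I-S)y\|\le\|x-y\|$ for all $x,y\in\mathcal{H}$. $\operatorname{zer}(S)=\{x\in\mathcal{H}: Sx=0\}$. For $i=1,\ldots,m$ the $i$th coordinate operator $S_i:\mathcal{H}\to\mathcal{H}$ is $S_ix=(0,\ldots,0,(Sx)_i,0,\ldots,0)$ (the $i$th block of $Sx$ in position $i$, zeros elsewhere). Cyclic Coordinate Update algorithm: given $x^0\in\mathcal{H}$, for each epoch $k=1,2,\ldots$, choose a permutation $(i_1,\ldots,i_m)$ of $(1,\ldots,m)$ (it may be any permutation and may differ from epoch to epoch) and a step size $\alpha_k>0$; set $y^0=x^{k-1}$;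 for $j=1,\ldots,m$ set $y^j=y^{j-1}-\alpha_kS_{i_j}(y^{j-1})$; finally set $x^k=y^m$. *)

(* Defs.v *)
From HB Require Import structures.
From mathcomp Require Import all_boot all_order all_fingroup all_algebra.
From mathcomp Require Import all_classical all_reals all_analysis.
From mathcomp Require Import ring lra.

Set Implicit Arguments.
Unset Strict Implicit.
Unset Printing Implicit Defensive.

Import Order.TTheory GRing.Theory Num.Theory.
Import numFieldNormedType.Exports.

Local Open Scope classical_set_scope.
Local Open Scope ring_scope.

(* Positive definiteness of the inner product follows from [hdotxx]. *)
HB.mixin Record isHilbert (R : realType) V & CompleteNormedModule R V := {
  hdot : V -> V -> R ;
  hdotC : forall x y, hdot x y = hdot y x ;
  hdotDl : forall x y z, hdot (x + y) z = hdot x z + hdot y z ;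
  hdotZl : forall (a : R) x y, hdot (a *: x) y = a * hdot x y ;
  hdotxx : forall x, hdot x x = `|x| ^+ 2
}.

#[short(type="hilbertType")]
HB.structure Definition Hilbert (R : realType) :=
  { V of CompleteNormedModule R V & isHilbert R V }.

Section hilbert_dot.
Context {R : realType} {V : hilbertType R}.

Let hdotP : bilinear_for
  (GRing.Scale.Law.clone _ _ *%R _)
  (GRing.Scale.Law.clone _ _ (idfun \; *%R) _) (@hdot R V).
Proof.
split=> [z|z] a x y; rewrite /=.
  by rewrite hdotDl hdotZl.
by rewrite ![hdot z _]hdotC hdotDl hdotZl.
Qed.

HB.instance Definition _ :=
  bilinear_isBilinear.Build R V V R *%R (idfun \; *%R) (@hdot R V) hdotP.

Let hdot_herm (x y : V) : hdot x y = (-1) ^+ false * idfun (hdot y x).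
Proof. by rewrite mul1r hdotC. Qed.

HB.instance Definition _ :=
  isHermitianSesquilinear.Build R V false idfun (@hdot R V) hdot_herm.

Let hdot_gt0 (x : V) : x != 0 -> 0 < hdot x x.
Proof. by move=> x0; rewrite hdotxx exprn_gt0// normr_gt0. Qed.

HB.instance Definition _ := isDotProduct.Build R V (@hdot R V) hdot_gt0.

End hilbert_dot.

(* An alias of [forall i, H i], which already carries the topology of pointwise
   convergence; here the structure is induced by the product inner product. *)
Definition hprod (R : realType) (m : nat) (H : 'I_m -> hilbertType R) : Type :=
  forall i, H i.

Section hprod_hilbert.
Context {R : realType} {m : nat} {H : 'I_m -> hilbertType R}.
Local Notation V := (hprod H).
Implicit Types x y z : V.

Definition hprod_add x y : V := fun i => x i + y i.
Definition hprod_opp x : V := fun i => - x i.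
Definition hprod_zero : V := fun i => 0.
Definition hprod_scale (a : R) x : V := fun i => a *: x i.

Let ext x y : (forall i, x i = y i) -> x = y.
Proof. exact: functional_extensionality_dep. Qed.

HB.instance Definition _ := gen_eqMixin V.
HB.instance Definition _ := gen_choiceMixin V.

Let addA : associative hprod_add.
Proof. by move=> x y z; apply: ext => i; exact: addrA. Qed.
Let addC : commutative hprod_add.
Proof. by move=> x y; apply: ext => i; exact: addrC. Qed.
Let add0 : left_id hprod_zero hprod_add.
Proof. by move=> x; apply: ext => i; exact: add0r. Qed.
Let addN : left_inverse hprod_zero hprod_opp hprod_add.
Proof. by move=> x; apply: ext => i; exact: addNr. Qed.

HB.instance Definition _ := GRing.isZmodule.Build V addA addC add0 addN.

Let scaleA (a b : R) x :
  hprod_scale a (hprod_scale b x) = hprod_scale (a * b) x.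
Proof. by apply: ext => i; exact: scalerA. Qed.
Let scale1 : left_id 1 hprod_scale.
Proof. by move=> x; apply: ext => i; exact: scale1r. Qed.
Let scaleDr : right_distributive hprod_scale +%R.
Proof. by move=> a x y; apply: ext => i; exact: scalerDr. Qed.
Let scaleDl x : {morph hprod_scale^~ x : a b / a + b}.
Proof. by move=> a b; apply: ext => i; exact: scalerDl. Qed.

HB.instance Definition _ :=
  GRing.Zmodule_isLmodule.Build R V scaleA scale1 scaleDr scaleDl.

Definition hprod_dot x y : R := \sum_(i < m) hdot (x i) (y i).
Definition hprod_norm x : R := Num.sqrt (hprod_dot x x).

Let dotC x y : hprod_dot x y = hprod_dot y x.
Proof. by apply: eq_bigr => i _; exact: hdotC. Qed.

Let dotDl x y z : hprod_dot (x + y) z = hprod_dot x z + hprod_dot y z.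
Proof.
by rewrite -big_split; apply: eq_bigr => i _; exact: hdotDl.
Qed.

Let dotZl (a : R) x y : hprod_dot (a *: x) y = a * hprod_dot x y.
Proof. by rewrite mulr_sumr; apply: eq_bigr => i _; exact: hdotZl. Qed.

Let dotxx_ge0 x : 0 <= hprod_dot x x.
Proof. by apply: sumr_ge0 => i _; rewrite hdotxx exprn_ge0. Qed.

Let dotxx x : hprod_dot x x = hprod_norm x ^+ 2.
Proof. by rewrite sqr_sqrtr. Qed.

Let norm_ge0 x : 0 <= hprod_norm x. Proof. exact: sqrtr_ge0. Qed.

Let normZ (a : R) x : hprod_norm (a *: x) = `|a| * hprod_norm x.
Proof.
rewrite /hprod_norm dotZl dotC dotZl mulrA -expr2 sqrtrM ?sqr_ge0//.
by rewrite sqrtr_sqr.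
Qed.

Let norm_proj x i : `|x i| <= hprod_norm x.
Proof.
rewrite -(@ler_pXn2r _ 2)// ?nnegrE ?norm_ge0// -dotxx -hdotxx.
rewrite /hprod_dot (bigD1 i)//= lerDl.
by apply: sumr_ge0 => j _; rewrite hdotxx exprn_ge0.
Qed.

Let norm0_eq0 x : hprod_norm x = 0 -> x = 0.
Proof.
move=> x0; apply: ext => i; apply/eqP; rewrite -normr_le0 -x0.
exact: norm_proj.
Qed.

Let dot_le x y : hprod_dot x y <= hprod_norm x * hprod_norm y.
Proof.
have [x0|x_neq0] := eqVneq (hprod_norm x) 0.
  by rewrite x0 mul0r (norm0_eq0 x0) -(scale0r (0 : V)) dotZl mul0r.
set d := hprod_dot x y; set a := hprod_norm x; set b := hprod_norm y.
have a_gt0 : 0 < a by rewrite lt_neqAle eq_sym x_neq0 norm_ge0.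
have ab_ge0 : 0 <= a * b by rewrite mulr_ge0 ?norm_ge0.
have : 0 <= a ^+ 2 * ((a * b) ^+ 2 - d ^+ 2).
  have := dotxx_ge0 (d *: x + (- a ^+ 2) *: y).
  rewrite dotDl !dotZl ![hprod_dot _ (_ + _)]dotC !dotDl !dotZl.
  rewrite !dotxx [hprod_dot y x]dotC -/a -/b -/d.
  by congr (0 <= _); ring.
rewrite pmulr_rge0 ?exprn_gt0// subr_ge0 => d_le.
apply: le_trans (ler_norm d) _.
by rewrite -(@ler_pXn2r _ 2)// ?nnegrE// real_normK ?num_real.
Qed.

Let normD x y : hprod_norm (x + y) <= hprod_norm x + hprod_norm y.
Proof.
rewrite -(@ler_pXn2r _ 2)// ?nnegrE ?addr_ge0 ?norm_ge0//.
rewrite -dotxx dotDl ![hprod_dot _ (_ + _)]dotC !dotDl !dotxx.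
rewrite [hprod_dot y x]dotC; have := dot_le x y; nra.
Qed.

HB.instance Definition _ := Lmodule_isNormed.Build R V normD normZ norm0_eq0.

Let norm_le_sum x : `|x| <= \sum_(i < m) `|x i|.
Proof.
rewrite -(@ler_pXn2r _ 2)// ?nnegrE ?sumr_ge0//.
rewrite [leLHS](_ : _ = \sum_(i < m) `|x i| ^+ 2); last first.
  by rewrite -dotxx; apply: eq_bigr => i _; exact: hdotxx.
rewrite expr2 mulr_suml; apply: ler_sum => i _.
rewrite expr2 ler_wpM2l//.
by rewrite (bigD1 i)//= lerDl sumr_ge0.
Qed.

Let complete (F : set_system V) : ProperFilter F -> cauchy F -> cvg F.
Proof.
move=> FF Fc.
have /(_ _)/cvg_ex Fi i : cvg ((fun x : V => x i) @ F).
  apply: cauchy_cvg; apply/cauchy_ballP => e e0.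
  have /cauchy_ballP/(_ e e0) := Fc.
  move=> -[[P Q] [FP FQ]] PQ.
  exists ((fun x : V => x i) @` P, (fun x : V => x i) @` Q) => /=.
    by split; [apply: filterS FP|apply: filterS FQ] => x Px; exists x.
  move=> [_ _] /= [[x Px <-] [y Qy <-]].
  have := PQ (x, y) (conj Px Qy); rewrite -!ball_normE /=.
  exact: le_lt_trans (norm_proj (x - y) i).
have {}Fi i : {l : H i | (fun x : V => x i) @ F --> l}.
  by apply: cid; exact: Fi.
apply/cvg_ex; exists (fun i => sval (Fi i)).
apply/cvgrPdist_le => e e0.
have m0 : 0 < (m%:R + 1 : R) by rewrite ltr_wpDl.
have : \forall x \near F, forall i, `|sval (Fi i) - x i| <= e / (m%:R + 1).
  apply: filter_forall => i.
  have /cvgrPdist_le/(_ (e / (m%:R + 1))) := svalP (Fi i).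
  by apply; rewrite divr_gt0.
apply: filterS => x xe; apply: le_trans (norm_le_sum _) _.
apply: (@le_trans _ _ (\sum_(i < m) e / (m%:R + 1))).
  by apply: ler_sum => i _; exact: xe.
rewrite sumr_const card_ord -[_ *+ m]mulr_natr mulrAC ler_pdivrMr//.
by rewrite ler_wpM2l ?lerDl// ltW.
Qed.

HB.instance Definition _ := Uniform_isComplete.Build V complete.
HB.instance Definition _ := isHilbert.Build R V dotC dotDl dotZl dotxx.

End hprod_hilbert.

Definition nonexpansive (R : realType) (V : hilbertType R) (T : V -> V) :=
  forall x y, `|T x - T y| <= `|x - y|.

Definition zer (R : realType) (V : hilbertType R) (S : V -> V) : set V :=
  [set x | S x = 0].

Definition weakly_cvg (R : realType) (V : hilbertType R) (x : nat -> V) (l : V) :=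
  forall v : V, hdot (x k) v @[k --> \oo] --> hdot l v.

Section cyclic_coordinate_update.
Context {R : realType} {m : nat} {H : 'I_m -> hilbertType R}.
Implicit Types (S : hprod H -> hprod H) (x y : hprod H).

Definition coord_op S (i : 'I_m) x : hprod H :=
  fun j => if j == i then S x j else 0.

Definition coord_update S (a : R) y (i : 'I_m) : hprod H :=
  y - a *: coord_op S i y.

(* The permutation [s] encodes the ordering [(s 0, ..., s (m-1))]. *)
Definition ccu_epoch S (a : R) (s : 'S_m) y : hprod H :=
  foldl (coord_update S a) y [seq s j | j <- enum 'I_m].

(* Epochs are numbered from 1: [alpha 0] and [s 0] are not used. *)
Definition ccu_sequence S (alpha : nat -> R) (s : nat -> 'S_m)
    (x : nat -> hprod H) :=
  forall k, (0 < k)%N -> x k = ccu_epoch S (alpha k) (s k) (x k.-1).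

End cyclic_coordinate_update.

(* Main.v *)
Require Import Defs.
From mathcomp Require Import all_boot all_order all_fingroup all_algebra.
From mathcomp Require Import all_classical all_reals all_analysis.
From mathcomp Require Import ring lra.

Set Implicit Arguments.
Unset Strict Implicit.
Unset Printing Implicit Defensive.

Import Order.TTheory GRing.Theory Num.Theory.
Import numFieldNormedType.Exports.

Local Open Scope classical_set_scope.
Local Open Scope ring_scope.

(** One epoch of coordinate updates is a damped fixed-point step up to a
second-order error: every partial update moves the point by [O(alpha |S x|)],
[S] is 2-Lipschitz, and the coordinate operators sum to [S] whatever their
order, so

  [x' = x - alpha S x + e]   with   [|e| <= 3^m alpha^2 |S x|]

([ccu_epoch_error]). It remains to see that the Krasnoselskii-Mann iteration
tolerates such errors when [sum alpha_k] diverges and [sum alpha_k^3]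
converges, which is the case of [alpha_k = k^(-1/2)]; note that
[sum alpha_k^2] diverges, so the errors are not obviously summable.

Nonexpansiveness of [I - S] says that [S] is 1/2-cocoercive. Hence an exact
step decreases [|x - p|^2], for a zero [p] of [S], by about
[alpha |S x|^2]. The cross term [2 <e, x - p>] is of size
[alpha^2 |S x| |x - p|]; completing a square, it costs one half of that
decrease plus [O(alpha^3) |x - p|^2] ([inexact_step_fejer]). By the
Robbins-Siegmund lemma, [|x_k - p|] converges for every zero [p], and
[sum alpha_k |S x_k|^2] converges. One step multiplies [|S x|^2] by at most
[1 + O(alpha)], so the sequence [|S x_k|^2] has summable upward increments and
converges; as [sum alpha_k] diverges, its limit is 0
([cvg0_weighted_summable]).

Opial's argument concludes. Along any ultrafilter finer than the filter of
cofinite sets, the bounded sequence [x_k] has a weak limit ([ultra_weak_cvg],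
from the Riesz representation theorem applied to the linear functional
[v |-> lim <x_k, v>]). By demiclosedness this limit is a zero of [S], and two
such limits [l], [c] coincide, because [|x_k - l|^2 - |x_k - c|^2] converges.
Ultrafilters play here the part of weakly convergent subsequences. *)

(** * Inner products and the Riesz representation theorem *)

Section hilbert_identities.
Context {R : realType} {V : hilbertType R}.
Implicit Types (x y z : V) (a : R).

Lemma hdotDr x y z : hdot x (y + z) = hdot x y + hdot x z.
Proof. by rewrite hdotC hdotDl !(hdotC _ x). Qed.

Lemma hdotZr a x y : hdot x (a *: y) = a * hdot x y.
Proof. by rewrite hdotC hdotZl hdotC. Qed.

Lemma hdotNl x y : hdot (- x) y = - hdot x y.
Proof. by rewrite -scaleN1r hdotZl mulN1r. Qed.

Lemma hdotNr x y : hdot x (- y) = - hdot x y.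
Proof. by rewrite hdotC hdotNl hdotC. Qed.

Lemma hdotBl x y z : hdot (x - y) z = hdot x z - hdot y z.
Proof. by rewrite hdotDl hdotNl. Qed.

Lemma hdotBr x y z : hdot x (y - z) = hdot x y - hdot x z.
Proof. by rewrite hdotDr hdotNr. Qed.

Lemma sqr_hnormD x y : `|x + y| ^+ 2 = `|x| ^+ 2 + 2 * hdot x y + `|y| ^+ 2.
Proof. by rewrite -!hdotxx hdotDl !hdotDr (hdotC y x); ring. Qed.

Lemma sqr_hnormB x y : `|x - y| ^+ 2 = `|x| ^+ 2 - 2 * hdot x y + `|y| ^+ 2.
Proof. by rewrite sqr_hnormD hdotNr normrN mulrN. Qed.

Lemma hdot_le x y : hdot x y <= `|x| * `|y|.
Proof.
have : `|x + y| ^+ 2 <= (`|x| + `|y|) ^+ 2.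
  by rewrite ler_pXn2r// ?nnegrE ?addr_ge0// ler_normD.
by rewrite sqr_hnormD; nra.
Qed.

Lemma norm_hdot_le x y : `|hdot x y| <= `|x| * `|y|.
Proof.
by rewrite ler_norml hdot_le andbT lerNl -hdotNl -(normrN x) hdot_le.
Qed.

End hilbert_identities.

(** The representing vector is the minimizer of [J z = |z|^2 - 2 f z]. By the
parallelogram identity, in the form [mid], a minimizing sequence is Cauchy; the
first-order condition at the minimizer is the representation. *)
Theorem riesz_representation (R : realType) (V : hilbertType R) (f : V -> R)
    (C : R) :
  (forall a u v, f (a *: u + v) = a * f u + f v) ->
  (forall v, `|f v| <= C * `|v|) ->
  exists c, forall v, f v = hdot c v.
Proof.
move=> flin fC.
pose J z : R := `|z| ^+ 2 - 2 * f z.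
have JE c z t : J (c + t *: z) =
    J c + 2 * t * (hdot c z - f z) + t ^+ 2 * `|z| ^+ 2.
  rewrite /J [c + _]addrC flin [_ + c]addrC sqr_hnormD hdotZr normrZ exprMn.
  by rewrite real_normK ?num_real//; ring.
have J_lb z : - C ^+ 2 <= J z.
  have := fC z; rewrite ler_norml => /andP[_ h]; rewrite /J.
  by have := sqr_ge0 (`|z| - C); nra.
have Jinf : has_inf (range J).
  by split; [exists (J 0), 0 | exists (- C ^+ 2) => _ [z _ <-]].
pose mu := inf (range J).
have mu_le z : mu <= J z by apply: ge_inf; [exact: Jinf.2 | exists z].
have /choice[z_ Jz_] n : exists z, J z < mu + harmonic n.
  have [_ [z _ <-] Jz] := inf_adherent (harmonic_gt0 n) Jinf.
  by exists z.
have mid u v : `|u - v| ^+ 2 <= 2 * (J u - mu) + 2 * (J v - mu).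
  have h0 : mu <= J v + 2 * 2^-1 * (hdot v (u - v) - f (u - v)) +
      2^-1 ^+ 2 * `|u - v| ^+ 2 by rewrite -JE.
  have -> : J u = J v + 2 * 1 * (hdot v (u - v) - f (u - v)) +
      1 ^+ 2 * `|u - v| ^+ 2.
    by rewrite -JE scale1r addrC subrK.
  by rewrite expr1n; lra.
have : cvgn z_.
  apply/cauchy_cvgP; apply: cauchy_exP => e e0.
  have e4 : 0 < e ^+ 2 / 4 by rewrite divr_gt0 ?exprn_gt0.
  have [N _ HN] : \forall n \near \oo, @harmonic R n < e ^+ 2 / 4.
    by apply: cvgr_lt e4; exact: cvg_harmonic.
  exists (z_ N); exists N => // n /= Nn; rewrite -ball_normE /=.
  rewrite -(@ltr_pXn2r _ 2)// ?nnegrE ?(ltW e0)//.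
  apply: le_lt_trans (mid _ _) _.
  have near_inf k : (N <= k)%N -> J (z_ k) - mu < e ^+ 2 / 4.
    by move=> Nk; rewrite ltrBlDl; apply: lt_trans (Jz_ k) _; rewrite ltrD2l HN.
  by have := near_inf _ (leqnn N); have := near_inf _ Nn; lra.
move=> /cvg_ex[c z_c]; exists c => v.
have Jc : J c <= mu.
  have Jz_c : (fun n => J (z_ n)) @ \oo --> J c.
    apply: cvgB.
      under eq_fun do rewrite expr2.
      by rewrite expr2; apply: cvgM; exact: cvg_norm.
    apply: cvgMl_tmp; apply/cvgrPdist_le => e e0.
    have C1 : 0 < `|C| + 1 by rewrite ltr_wpDl.
    have /cvgrPdist_le/(_ (e / (`|C| + 1))) := z_c.
    rewrite divr_gt0// => /(_ isT); apply: filterS => n h.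
    have -> : f c - f (z_ n) = f (c - z_ n).
      by rewrite [c - _]addrC -(scaleN1r (z_ n)) flin; ring.
    apply: le_trans (fC _) _; rewrite ler_pdivlMr// in h.
    by have := ler_norm C; have := normr_ge0 (c - z_ n); nra.
  have Jz_mu : (fun n => mu + @harmonic R n) @ \oo --> mu + 0.
    by apply: cvgD; [exact: cvg_cst | exact: cvg_harmonic].
  rewrite -[leRHS]addr0; apply: ler_cvg_to Jz_c Jz_mu _.
  by apply: nearW => n; exact/ltW/Jz_.
have lo t : 0 <= 2 * t * (hdot c v - f v) + t ^+ 2 * `|v| ^+ 2.
  by have := mu_le (c + t *: v); rewrite JE; lra.
(* a nonzero slope [d] at [t = 0] would make the quadratic negative at
   [t = - d / (|v|^2 + 1)]; the added 1 covers [v = 0] *)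
set d := hdot c v - f v in lo.
have w0 : 0 < `|v| ^+ 2 + 1 by rewrite ltr_wpDl// sqr_ge0.
have /eqP : d ^+ 2 = 0.
  apply/le_anti; rewrite sqr_ge0 andbT.
  have := lo (- d / (`|v| ^+ 2 + 1)).
  set w : R := `|v| ^+ 2 + 1 in w0 *.
  have -> : `|v| ^+ 2 = w - 1 by rewrite /w addrK.
  have -> : 2 * (- d / w) * d + (- d / w) ^+ 2 * (w - 1) =
     (- d ^+ 2) * ((w + 1) / w ^+ 2) by field; rewrite gt_eqF.
  rewrite mulNr oppr_ge0 pmulr_lle0//.
  by rewrite divr_gt0 ?exprn_gt0// ltr_wpDl// ltW.
by rewrite sqrf_eq0 subr_eq0 => /eqP.
Qed.

(** * Weak limits along ultrafilters *)

Lemma ultra_cvg_bounded (R : realType) (T : Type) (U : set_system T)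
    (UU : UltraFilter U) (u : T -> R) (C : R) :
  (forall t, `|u t| <= C) -> cvg (u t @[t --> U]).
Proof.
move=> uC.
have UK : (u @ U) [set` `[- C, C]].
  by apply: (@filterE _ U) => t /=; rewrite in_itv/= -ler_norml.
have [p [_ clp]] := @segment_compact R (- C) C (u @ U) _ UK.
apply/cvg_ex; exists p => A /= pA.
have [//|UnA] := in_ultra_setVsetC (u @^-1` A) UU.
by have [q [nAq Aq]] := clp (~` A) A UnA pA.
Qed.

(** A filter is the intersection of the ultrafilters finer than it. *)
Lemma cvg_ultraP (T : Type) (Y : topologicalType) (F : set_system T)
    (FF : Filter F) (f : T -> Y) (l : Y) :
  (forall U : set_system T, UltraFilter U -> F `<=` U -> f @ U --> l) ->
  f @ F --> l.
Proof.
move=> fU A /= lA; apply: contrapT => FnA.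
have WF : ProperFilter (within (f @^-1` (~` A)) F).
  split; last exact: within_filter.
  by move=> W0; apply: FnA; apply: (@filterS _ F) W0 => t /= /contrapT.
have [U [UU WU]] := ultraFilterLemma WF.
have FU : F `<=` U.
  by move=> B FB; apply: WU; apply: (@filterS _ F) FB => t Bt _.
have UA : U (f @^-1` A) := fU U UU FU A lA.
have UnA : U (f @^-1` (~` A)) by apply: WU; apply: (@filterE _ F) => t.
by have [t []] := filter_ex (filterI UA UnA).
Qed.

(** Weak compactness of balls, obtained without a topology on the dual: the
functional [v |-> lim <x t, v>] is linear and bounded, hence represented by a
vector, which is the weak limit. *)
Lemma ultra_weak_cvg (R : realType) (V : hilbertType R) (T : Type)
    (U : set_system T) (UU : UltraFilter U) (x : T -> V) (C : R) :
  (forall t, `|x t| <= C) ->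
  exists c, forall v, hdot (x t) v @[t --> U] --> hdot c v.
Proof.
move=> xC.
have dot_bd v t : `|hdot (x t) v| <= C * `|v|.
  by apply: le_trans (norm_hdot_le _ _) _; rewrite ler_wpM2r.
have dot_cvg v : cvg (hdot (x t) v @[t --> U]).
  exact: ultra_cvg_bounded (dot_bd v).
pose f v := lim (hdot (x t) v @[t --> U]).
have [] := @riesz_representation R V f C.
- move=> a u v; apply: cvg_lim => //.
  under eq_fun do rewrite hdotDr hdotZr.
  by apply: cvgD; [apply: cvgMl_tmp; exact: dot_cvg | exact: dot_cvg].
- move=> v; have fv : `|hdot (x t) v| @[t --> U] --> `|f v|.
    by apply: cvg_norm; exact: dot_cvg.
  apply: (cvgr_to_le fv).
  by apply: nearW => t; exact: dot_bd.
- by move=> c fE; exists c => v; rewrite -fE; exact: dot_cvg.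
Qed.

Lemma bounded_of_sqr_dist (R : realType) (V : normedModType R)
    (x : nat -> V) p :
  cvgn (fun k => `|x k - p| ^+ 2) -> exists C, forall k, `|x k| <= C.
Proof.
move=> /cvg_seq_bounded/bounded_fun_has_ubound[M ubM].
exists (M + 1 + `|p|) => k.
rewrite -[x k](subrK p); apply: le_trans (ler_normD _ _) _.
rewrite lerD2r; have := ubM _ (ex_intro2 _ _ k I erefl) => /=.
by have := sqr_ge0 (`|x k - p| - 1); have := normr_ge0 (x k - p); nra.
Qed.

(** Opial's argument: if [l] and [c] are two weak cluster points lying in [F],
then [<x_k, l - c>] is, up to constants, half the difference
[|x_k - c|^2 - |x_k - l|^2], so it converges; its limit is both [<l, l - c>]
and [<c, l - c>], whence [|l - c|^2 = 0]. *)
Lemma opial (R : realType) (V : hilbertType R) (x : nat -> V) (F : set V) :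
  (forall p, F p -> cvgn (fun k => `|x k - p| ^+ 2)) ->
  (forall (U : set_system nat) c, UltraFilter U -> \oo `<=` U ->
    (forall v, hdot (x k) v @[k --> U] --> hdot c v) -> F c) ->
  F !=set0 ->
  exists2 l, F l & weakly_cvg x l.
Proof.
move=> dist_cvg Fclus [p Fp].
have [C xC] := bounded_of_sqr_dist (dist_cvg _ Fp).
have [U [UU ooU]] := ultraFilterLemma eventually_filter.
have [l xl] := ultra_weak_cvg UU xC.
have Fl := Fclus _ _ UU ooU xl.
exists l => // v; apply: cvg_ultraP => U' UU' ooU'.
have [c xc] := ultra_weak_cvg UU' xC.
suff -> : l = c by exact: xc.
have Fc := Fclus _ _ UU' ooU' xc.
have lc_cvg : cvgn (fun k => hdot (x k) (l - c)).
  have -> : (fun k => hdot (x k) (l - c)) = (fun k =>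
      2^-1 * (`|x k - c| ^+ 2 - `|x k - l| ^+ 2 + (`|l| ^+ 2 - `|c| ^+ 2))).
    by apply/funext => k; rewrite !sqr_hnormB hdotBr; field.
  apply: is_cvgMl_tmp; apply: is_cvgD; last exact: is_cvg_cst.
  by apply: is_cvgB; exact: dist_cvg.
have ultra_lim (W : set_system nat) d : UltraFilter W -> \oo `<=` W ->
    (forall v, hdot (x k) v @[k --> W] --> hdot d v) ->
    hdot d (l - c) = limn (fun k => hdot (x k) (l - c)).
  move=> UW ooW xd; apply: (cvg_unique _ (xd (l - c))) => //.
  by move=> A /= /lc_cvg; exact: ooW.
apply/eqP; rewrite -subr_eq0 -normr_eq0 -sqrf_eq0 -hdotxx hdotBl.
by rewrite (ultra_lim U) // (ultra_lim U') // subrr.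
Qed.

(** * Operators whose complement is nonexpansive *)

Section nonexpansive_complement.
Context {R : realType} {V : hilbertType R} {S : V -> V}.
Hypothesis S_ne : nonexpansive (fun z => z - S z).

(** Expanding the square of [(x - y) - (S x - S y)] turns nonexpansiveness of
[I - S] into 1/2-cocoercivity of [S]. *)
Lemma cocoercive x y : `|S x - S y| ^+ 2 <= 2 * hdot (S x - S y) (x - y).
Proof.
have := S_ne x y; rewrite -(@ler_pXn2r _ 2)// ?nnegrE//.
have -> : x - S x - (y - S y) = (x - y) - (S x - S y).
  by rewrite !opprD !opprK addrACA.
by rewrite [leLHS]sqr_hnormB hdotC; lra.
Qed.

Lemma lipschitz2 x y : `|S x - S y| <= 2 * `|x - y|.
Proof.
have := cocoercive x y; have := hdot_le (S x - S y) (x - y).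
have := normr_ge0 (S x - S y); have := normr_ge0 (x - y).
set a := `|x - y|; set b := `|S x - S y| => a0 b0 h1 h2.
rewrite leNgt; apply/negP => ab; have b_gt0 : 0 < b by lra.
by nra.
Qed.

(** Cocoercivity between [x k] and [c] bounds [|S (x k) - S c|^2] by a quantity
that tends to 0: the part carrying [S (x k)] since [x] is bounded, the part
carrying [S c] by weak convergence. *)
Lemma demiclosed (F : set_system nat) (FF : ProperFilter F) (x : nat -> V)
    (C : R) c :
  (forall k, `|x k| <= C) ->
  (forall v, hdot (x k) v @[k --> F] --> hdot c v) ->
  `|S (x k)| @[k --> F] --> 0 ->
  S c = 0.
Proof.
move=> xC xc Sx0.
(* cocoercivity, expanded in the terms whose limits are known *)
have bound k : `|S c| ^+ 2 <=
    2 * (`|S (x k)| * (C + `|c| + `|S c|))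
    - 2 * (hdot (x k) (S c) - hdot c (S c)).
  have := cocoercive (x k) c; rewrite sqr_hnormB.
  rewrite hdotBl !hdotBr (hdotC (S c) (x k)) (hdotC (S c) c).
  have h1 := hdot_le (S (x k)) (x k).
  have h2 := hdot_le (S (x k)) (- c); rewrite hdotNr normrN in h2.
  have h3 := hdot_le (S (x k)) (S c).
  have h4 : `|S (x k)| * `|x k| <= `|S (x k)| * C by rewrite ler_wpM2l.
  have h5 := sqr_ge0 (`|S (x k)|).
  by rewrite !mulrDr; lra.
apply/eqP; rewrite -normr_eq0 -sqrf_eq0 eq_le sqr_ge0 andbT.
have lim0 : 2 * (`|S (x k)| * (C + `|c| + `|S c|))
    - 2 * (hdot (x k) (S c) - hdot c (S c)) @[k --> F] -->
    2 * (0 * (C + `|c| + `|S c|)) - 2 * (hdot c (S c) - hdot c (S c)).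
  apply: cvgB; apply: cvgMl_tmp; first exact: cvgMr_tmp.
  by apply: cvgB => //; exact: cvg_cst.
rewrite mul0r subrr mulr0 subrr in lim0.
apply: (cvgr_to_ge lim0).
by apply: nearW => k; exact: bound.
Qed.

End nonexpansive_complement.

(** * Real sequences with summable perturbations *)

Lemma cvg_series_shift (R : realType) (u : R^nat) N :
  cvgn (series (fun k => u (k + N)%N)) <-> cvgn (series u).
Proof.
have shiftE n :
    series (fun k => u (k + N)%N) n = series u (n + N)%N - series u N.
  by rewrite sub_series_geq ?leq_addl// -{2}(add0n N) big_addn addnK.
split=> /cvg_ex[l ul]; apply/cvg_ex.
- exists (l + series u N); rewrite -(@cvg_shiftn N).
  have -> : [sequence series u (n + N)%N]_n =
      (fun n => series (fun k => u (k + N)%N) n + series u N).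
    by apply/funext => n; rewrite shiftE subrK.
  by apply: cvgD => //; exact: cvg_cst.
- exists (l - series u N); rewrite (funext shiftE).
  by apply: cvgB; [rewrite (cvg_shiftn N) | exact: cvg_cst].
Qed.

Lemma cvg_series_ge0 (R : realType) (u : R^nat) (M : R) :
  (forall n, 0 <= u n) -> (forall n, series u n <= M) -> cvgn (series u).
Proof.
move=> u0 uM; apply: nondecreasing_is_cvgn; first exact: nondecreasing_series.
by exists M => _ [n _ <-].
Qed.

(** Dividing by the products [P n] of the factors [1 + t k] removes these
factors; [P] is bounded by the exponential of [sum t]. The quotient [w] minus
the partial sums of [s] is then nonincreasing, and its total decrease bounds
[sum v]. *)
Lemma robbins_siegmund (R : realType) (u v s t : R^nat) :
  (forall k, 0 <= u k) -> (forall k, 0 <= v k) ->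
  (forall k, 0 <= s k) -> (forall k, 0 <= t k) ->
  (forall k, u k.+1 <= (1 + t k) * u k + s k - v k) ->
  cvgn (series s) -> cvgn (series t) ->
  cvgn u /\ cvgn (series v).
Proof.
move=> u0 v0 s0 t0 rec cs ct.
have [Ms sM] : exists M, forall n, series s n <= M.
  have /cvg_seq_bounded/bounded_fun_has_ubound[M ub] := cs.
  by exists M => n; apply: ub; exists n.
have [Mt tM] : exists M, forall n, series t n <= M.
  have /cvg_seq_bounded/bounded_fun_has_ubound[M ub] := ct.
  by exists M => n; apply: ub; exists n.
pose P n : R := \prod_(k < n) (1 + t k).
have PS n : P n.+1 = P n * (1 + t n) by rewrite /P big_ord_recr.
have P1 n : 1 <= P n.
  elim: n => [|n IH]; first by rewrite /P big_ord0.
  by rewrite PS; have := t0 n; nra.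
have P0 n : 0 < P n by exact: lt_le_trans (P1 n).
have PE n : P n <= expR Mt.
  apply: (@le_trans _ _ (expR (series t n))); last by rewrite ler_expR.
  elim: n => [|n IH]; first by rewrite /P big_ord0 /series/= big_geq// expR0.
  rewrite PS seriesSr expRD; apply: ler_pM IH (expR_ge1Dx _); first exact: ltW.
  by rewrite addr_ge0.
pose w n := u n / P n.
have w0 n : 0 <= w n by rewrite divr_ge0// ltW.
have wS n : w n.+1 + v n / P n.+1 <= w n + s n.
  have -> : w n + s n = ((1 + t n) * u n + s n * P n.+1) / P n.+1.
    rewrite /w PS; field; rewrite (gt_eqF (P0 n)) /=.
    by rewrite gt_eqF// ltr_wpDr.
  rewrite /w -mulrDl ler_pM2r ?invr_gt0//.
  by have := rec n; have := P1 n.+1; have := s0 n; nra.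
have w_cvg : cvgn w.
  have -> : w = (fun n => (w n - series s n) + series s n).
    by apply/funext => n; rewrite subrK.
  apply: is_cvgD => //; apply: nonincreasing_is_cvgn.
    apply/nonincreasing_seqP => n; rewrite seriesSr.
    have := wS n; have : 0 <= v n / P n.+1 by rewrite divr_ge0// ltW.
    by lra.
  by exists (- Ms) => _ [n _ <-]; have := w0 n; have := sM n; lra.
split.
- have -> : u = (fun n => w n * P n).
    by apply/funext => n; rewrite /w divfK// gt_eqF.
  apply: is_cvgM => //; apply: nondecreasing_is_cvgn.
    apply/nondecreasing_seqP => n; rewrite PS.
    by have := t0 n; have := P0 n; nra.
  by exists (expR Mt) => _ [n _ <-].
- apply: (@cvg_series_ge0 _ _ (expR Mt * (w 0%N + Ms))) => // n.
  apply: (@le_trans _ _ (expR Mt * (w 0%N - w n + series s n))); last first.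
    by rewrite ler_wpM2l ?expR_ge0//; have := w0 n; have := sM n; lra.
  elim: n => [|n IH].
    by rewrite /series/= !big_geq// subrr addr0 mulr0.
  rewrite !seriesSr.
  have : v n <= expR Mt * (v n / P n.+1).
    rewrite mulrCA -[leLHS]mulr1 ler_wpM2l// ler_pdivlMr// mul1r.
    exact: PE.
  have := wS n; have := expR_gt0 Mt; move: IH.
  set E := expR Mt; set q := v n / P n.+1 => IH E0 h1 h2.
  have : E * q <= E * (w n + s n - w n.+1) by rewrite ler_pM2l//; lra.
  by lra.
Qed.

(** Summability of [a k * b k] with [sum a] divergent only gives a zero lower
limit of [b]. The growth condition makes the upward increments of [b]
summable, being at most [K * (a k * b k)]; hence [b] has a limit, and a positive
one would make [a] summable. *)
Lemma cvg0_weighted_summable (R : realType) (a b : R^nat) (K : R) :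
  0 <= K -> (forall k, 0 < a k) -> (forall k, 0 <= b k) ->
  (forall k, b k.+1 <= (1 + K * a k) * b k) ->
  ~ cvgn (series a) -> cvgn (series (fun k => a k * b k)) ->
  b @ \oo --> 0.
Proof.
move=> K0 a0 b0 rec dva cab.
have [] := @robbins_siegmund R b (fun=> 0) (fun k => K * (a k * b k)) (fun=> 0).
- by [].
- by [].
- by move=> k; rewrite !mulr_ge0// ltW.
- by [].
- by move=> k; apply: le_trans (rec k) _; rewrite addr0 subr0; lra.
- exact: (is_cvg_seriesZ cab).
- apply: (@cvg_series_ge0 _ _ 0) => // n.
  by rewrite /series /= big1.
move=> /cvg_ex[l bl] _.
have l0 : 0 <= l by apply: (cvgr_to_ge bl); exact: nearW.
have [l_eq0|l_neq0] := eqVneq l 0; first by rewrite -l_eq0.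
have l_gt0 : 0 < l by rewrite lt_neqAle eq_sym l_neq0.
have l2 : l / 2 < l by lra.
have [N _ bN] := cvgr_gt _ bl _ l2.
exfalso; apply: dva; apply/(cvg_series_shift a N).
apply: (@series_le_cvg R _ (fun k => (l / 2)^-1 * (a (k + N)%N * b (k + N)%N))).
- by move=> k; rewrite ltW.
- by move=> k; rewrite !mulr_ge0 ?invr_ge0 ?divr_ge0// ltW.
- move=> k; rewrite mulrC ler_pdivlMr ?divr_gt0// ler_pM2l//.
  by apply/ltW/bN; rewrite /= leq_addl.
- apply: is_cvg_seriesZ.
  exact/(cvg_series_shift (fun k => a k * b k) N).
Qed.

(** * The inexact Krasnoselskii-Mann iteration *)

Section inexact_step.
Context {R : realType} {V : hilbertType R} {S : V -> V}.
Hypothesis S_ne : nonexpansive (fun z => z - S z).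
Variables (C a : R) (x e : V).
Hypotheses (C0 : 0 <= C) (a0 : 0 < a).
Hypothesis e_le : `|e| <= C * a ^+ 2 * `|S x|.

(** The exact step decreases the squared distance by [a (1 - a) |S x|^2]; the
bound on [a] leaves a quarter of [a |S x|^2] once the error terms have been
absorbed. *)
Lemma inexact_step_fejer p : S p = 0 -> a * (1 + C ^+ 2) <= 4^-1 ->
  `|x - a *: S x + e - p| ^+ 2 <=
    (1 + 2 * C ^+ 2 * a ^+ 3) * `|x - p| ^+ 2 - a / 4 * `|S x| ^+ 2.
Proof.
move=> Sp a_small.
have := cocoercive S_ne x p; rewrite Sp subr0 => coco.
set z := x - p - a *: S x.
have -> : x - a *: S x + e - p = z + e by rewrite /z addrAC (addrAC x).
have zE : `|z| ^+ 2 = `|x - p| ^+ 2 - 2 * a * hdot (S x) (x - p)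
    + a ^+ 2 * `|S x| ^+ 2.
  rewrite /z sqr_hnormB hdotZr normrZ exprMn real_normK ?num_real//.
  by rewrite hdotC; ring.
have := hdot_le z e; rewrite sqr_hnormD.
move: zE coco (e_le).
have := normr_ge0 z; have := normr_ge0 e.
have := normr_ge0 (S x); have := normr_ge0 (x - p).
move: (`|z|) (`|e|) (`|S x|) (`|x - p|) (hdot z e) (hdot _ _).
move=> r n b d i h d0 b0 n0 r0 zE coco n_le i_le {z Sp}.
have C20 : 0 <= C ^+ 2 by exact: sqr_ge0.
have a1 : a <= 4^-1 by nra.
have r2 : r ^+ 2 <= d ^+ 2 - a * b ^+ 2 + a ^+ 2 * b ^+ 2.
  have : a * b ^+ 2 <= a * (2 * h) by rewrite ler_pM2l.
  by rewrite zE; lra.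
have rd : r <= d.
  rewrite -(@ler_pXn2r _ 2)// ?nnegrE//; apply: le_trans r2 _.
  have -> : d ^+ 2 - a * b ^+ 2 + a ^+ 2 * b ^+ 2 =
    d ^+ 2 - a * (1 - a) * b ^+ 2 by ring.
  rewrite lerBlDr lerDl mulr_ge0 ?sqr_ge0// mulr_ge0 ?ltW//.
  by rewrite subr_gt0; lra.
have rn : r * n <= d * (C * a ^+ 2 * b) by rewrite ler_pM.
have n2 : n ^+ 2 <= (C * a ^+ 2 * b) ^+ 2.
  by rewrite ler_pXn2r ?nnegrE//; exact: le_trans n_le.
(* the weights of this square are such that its [b^2] part is half of the
   decrease and its [d^2] part is of order [a^3] *)
have cross : 0 <= a / 2 * (b - 2 * C * a * d) ^+ 2.
  by rewrite mulr_ge0 ?sqr_ge0// divr_ge0// ltW.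
have crossE : a / 2 * (b - 2 * C * a * d) ^+ 2 =
    a / 2 * b ^+ 2 - 2 * (d * (C * a ^+ 2 * b)) + 2 * C ^+ 2 * a ^+ 3 * d ^+ 2.
  by field.
have slack : 0 <= a * b ^+ 2 * (4^-1 - a - C ^+ 2 * a ^+ 3).
  rewrite mulr_ge0//; first by rewrite mulr_ge0 ?sqr_ge0// ltW.
  have : C ^+ 2 * a ^+ 3 <= C ^+ 2 * a.
    rewrite ler_wpM2l// exprS -[leRHS]mulr1 ler_pM2l//.
    by rewrite exprn_ile1 ?ltW//; lra.
  by lra.
have n2E : (C * a ^+ 2 * b) ^+ 2 = a * b ^+ 2 * (C ^+ 2 * a ^+ 3) by ring.
rewrite n2E in n2; rewrite crossE in cross.
by lra.
Qed.

Lemma inexact_step_residual : a <= 1 ->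
  `|S (x - a *: S x + e)| ^+ 2 <=
    (1 + (2 * (2 * (1 + C)) + (2 * (1 + C)) ^+ 2) * a) * `|S x| ^+ 2.
Proof.
move=> a1; set L := 2 * (1 + C).
have move_le : `|x - a *: S x + e - x| <= a * `|S x| + C * a ^+ 2 * `|S x|.
  rewrite addrAC addrC (addrC x) addrK (le_trans (ler_normD _ _))//.
  by rewrite normrN normrZ gtr0_norm// [leRHS]addrC lerD2r.
have S_le : `|S (x - a *: S x + e)| <= (1 + L * a) * `|S x|.
  rewrite -[S (x - _ + _)](subrK (S x)); apply: le_trans (ler_normD _ _) _.
  have := lipschitz2 S_ne (x - a *: S x + e) x.
  have : C * a ^+ 2 * `|S x| <= C * a * `|S x|.
    by rewrite ler_wpM2r// ler_wpM2l// expr2 ler_piMl// ltW.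
  by move: move_le; rewrite /L; lra.
have L0 : 0 <= L by rewrite mulr_ge0// addr_ge0.
apply: (@le_trans _ _ (((1 + L * a) * `|S x|) ^+ 2)).
  by rewrite ler_pXn2r ?nnegrE// mulr_ge0// addr_ge0// mulr_ge0// ltW.
rewrite exprMn ler_wpM2r ?sqr_ge0//.
have : L ^+ 2 * a ^+ 2 <= L ^+ 2 * a.
  by rewrite ler_wpM2l ?sqr_ge0// expr2 ler_piMl// ltW.
by move=> ?; rewrite sqrrD expr1n exprMn; lra.
Qed.

End inexact_step.

(** Errors of relative size [a_k^2] are harmless although [sum a_k^2] may
diverge: only [sum a_k^3] enters the quasi-Fejer inequality. *)
Theorem inexact_krasnoselskii_mann (R : realType) (V : hilbertType R)
    (S : V -> V) (C : R) (a : R^nat) (x e : nat -> V) :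
  nonexpansive (fun z => z - S z) -> zer S !=set0 -> 0 <= C ->
  (forall k, 0 < a k) ->
  ~ cvgn (series a) -> cvgn (series (fun k => a k ^+ 3)) ->
  (forall k, x k.+1 = x k - a k *: S (x k) + e k) ->
  (forall k, `|e k| <= C * a k ^+ 2 * `|S (x k)|) ->
  exists2 l, zer S l & weakly_cvg x l.
Proof.
move=> S_ne Sz C0 a0 dva cva3 xS e_le.
(* the step sizes tend to 0, and weak convergence only concerns the tail *)
wlog a_small : a x e a0 dva cva3 xS e_le /
    forall k, a k * (1 + C ^+ 2) <= 4^-1.
  move=> small_case.
  have C1 : 0 < 1 + C ^+ 2 by rewrite ltr_wpDr ?sqr_ge0.
  pose d : R := 4^-1 / (1 + C ^+ 2).
  have d0 : 0 < d by rewrite divr_gt0.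
  have d3 : 0 < d ^+ 3 by rewrite exprn_gt0.
  have [N _ aN] := cvgr_lt _ (cvg_series_cvg_0 cva3) _ d3.
  have [] := small_case (fun k => a (k + N)%N) (fun k => x (k + N)%N)
    (fun k => e (k + N)%N).
  - by move=> k; exact: a0.
  - by move/(cvg_series_shift a N).
  - exact/(cvg_series_shift (fun k => a k ^+ 3) N).
  - by move=> k; rewrite addSn; exact: xS.
  - by move=> k; exact: e_le.
  - move=> k; rewrite -ler_pdivlMr// -/d ltW//.
    rewrite -(@ltr_pXn2r _ 3)// ?nnegrE ?(ltW (a0 _)) ?(ltW d0)//.
    by apply: aN; rewrite /= leq_addl.
  - move=> l Sl xl; exists l => // v.
    by rewrite -(@cvg_shiftn N); exact: xl.
have a1 k : a k <= 1.
  by have := a_small k; have := sqr_ge0 C; have := a0 k; nra.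
have fejer p : zer S p -> cvgn (fun k => `|x k - p| ^+ 2) /\
    cvgn (series (fun k => a k / 4 * `|S (x k)| ^+ 2)).
  move=> Sp.
  apply: (@robbins_siegmund R _ _ (fun=> 0)
      (fun k => 2 * C ^+ 2 * a k ^+ 3)).
  - by move=> k; exact: sqr_ge0.
  - by move=> k; rewrite mulr_ge0 ?sqr_ge0// divr_ge0// ltW.
  - by [].
  - move=> k; apply: mulr_ge0; first by rewrite mulr_ge0// sqr_ge0.
    by rewrite exprn_ge0// ltW.
  - by move=> k; rewrite addr0 xS; exact: inexact_step_fejer.
  - by apply: (@cvg_series_ge0 _ _ 0) => // n; rewrite /series /= big1.
  - exact: (is_cvg_seriesZ cva3).
have res0 : (fun k => `|S (x k)| ^+ 2) @ \oo --> 0.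
  have [p Sp] := Sz; have [_ sum_cvg] := fejer _ Sp.
  pose L : R := 2 * (1 + C).
  have L0 : 0 <= L by rewrite /L; lra.
  apply: (@cvg0_weighted_summable R a _ (2 * L + L ^+ 2)) => //.
  - by rewrite addr_ge0 ?sqr_ge0// mulr_ge0.
  - by move=> k; rewrite xS; exact: inexact_step_residual.
  - have -> : (fun k => a k * `|S (x k)| ^+ 2) =
        (fun k => 4 * (a k / 4 * `|S (x k)| ^+ 2)).
      by apply/funext => k; field.
    exact: (is_cvg_seriesZ sum_cvg).
apply: opial => // [p /fejer[]//|U c UU ooU xc].
have [p Sp] := Sz; have [dist_cvg _] := fejer _ Sp.
have [M xM] : exists M, forall k, `|x k| <= M.
  exact: bounded_of_sqr_dist dist_cvg.
rewrite /zer /=; apply: (demiclosed S_ne _ xM xc) => A /= A0; apply: ooU.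
suff : (fun k => `|S (x k)|) @ \oo --> 0 by apply.
have -> : (fun k => `|S (x k)|) = (fun k => Num.sqrt (`|S (x k)| ^+ 2)).
  by apply/funext => k; rewrite sqrtr_sqr normr_id.
by rewrite -sqrtr0; apply: continuous_cvg => //; exact: sqrt_continuous.
Qed.

(** * The error of one epoch *)

Section epoch_error.
Context {R : realType} {m : nat} {H : 'I_m -> hilbertType R}.
Implicit Types (x y z : hprod H) (i j : 'I_m).

Definition block i z : hprod H := fun j => if j == i then z j else 0.

Lemma blockB i x y : block i x - block i y = block i (x - y).
Proof.
apply: functional_extensionality_dep => j; rewrite /block.
change ((if j == i then x j else 0) - (if j == i then y j else 0) =
  (if j == i then x j - y j else 0)).
by case: ifP; rewrite ?subrr.
Qed.

Lemma sqr_hprod_norm z : `|z| ^+ 2 = \sum_(i < m) `|z i| ^+ 2.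
Proof. by rewrite -hdotxx; apply: eq_bigr => i _; rewrite hdotxx. Qed.

Lemma block_norm_le i z : `|block i z| <= `|z|.
Proof.
rewrite -(@ler_pXn2r _ 2)// ?nnegrE// !sqr_hprod_norm; apply: ler_sum => j _.
by rewrite /block; case: ifP => // _; rewrite normr0 expr0n sqr_ge0.
Qed.

Lemma sum_block z : \sum_(i < m) block i z = z.
Proof.
apply: functional_extensionality_dep => j.
have -> : (\sum_(i < m) block i z) j = \sum_(i < m) block i z j.
  by elim/big_rec2 : _ => // i _ y _ <-.
rewrite (bigD1 j)//= {1}/block eqxx big1 ?addr0// => i ij.
by rewrite /block eq_sym (negbTE ij).
Qed.

Variables (S : hprod H -> hprod H) (a : R).
Hypothesis S_ne : nonexpansive (fun z => z - S z).
Hypotheses (a0 : 0 <= a) (a1 : a <= 1).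

(** Both bounds are propagated by an update: with [D] the first left-hand side
and [E] the second one, [D' <= 3 D + a |S x|], since [|S y| <= |S x| + 2 D] and
[a <= 1], and [E' <= E + 2 a D]. The [- 1] in the bound on [D] absorbs the term
[a |S x|]. *)
Lemma coord_sweep_error x (r : seq 'I_m) :
  let y := foldl (coord_update S a) x r in
  `|y - x| <= a * (3 ^+ size r - 1) * `|S x| /\
  `|y - (x - a *: \sum_(i <- r) block i (S x))|
    <= a ^+ 2 * 3 ^+ size r * `|S x|.
Proof.
elim/last_ind: r => [|r i [IHd IHe]] /=.
  rewrite big_nil scaler0 subr0 subrr normr0 !expr0 subrr mulr0 mul0r.
  by split=> //; rewrite !mulr_ge0 ?sqr_ge0.
rewrite foldl_rcons big_rcons /= size_rcons exprS.
move: IHd IHe; set y := foldl _ _ _; set T : R := 3 ^+ size r => IHd IHe.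
rewrite -[coord_update S a y i]/(y - a *: block i (S y)).
have b0 := normr_ge0 (S x).
have T1 : 1 <= T by rewrite exprn_ege1// ler1n.
have Sy := lipschitz2 S_ne y x.
have aD : a * `|y - x| <= `|y - x| by rewrite ler_piMl.
have ab := mulr_ge0 a0 b0.
split.
- have : `|y - a *: block i (S y) - x| <= `|y - x| + a * `|S y|.
    rewrite addrAC; apply: le_trans (ler_normB _ _) _.
    by rewrite lerD2l normrZ ger0_norm// ler_wpM2l// block_norm_le.
  have : a * `|S y| <= a * (`|S x| + 2 * `|y - x|).
    rewrite ler_wpM2l// -[S y](subrK (S x)).
    by apply: le_trans (ler_normD _ _) _; lra.
  by move: IHd; lra.
- have -> : y - a *: block i (S y) -
      (x - a *: (\sum_(j <- r) block j (S x) + block i (S x))) =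
      y - (x - a *: \sum_(j <- r) block j (S x)) -
      a *: block i (S y - S x).
    rewrite -blockB scalerDr scalerBr !opprB -!addrA; congr (_ + _).
    by rewrite addrC -!addrA; congr (_ + _); rewrite addrCA.
  apply: le_trans (ler_normB _ _) _; rewrite normrZ ger0_norm//.
  have h1 : a * `|block i (S y - S x)| <= a * (2 * `|y - x|).
    by rewrite ler_wpM2l// (le_trans (block_norm_le _ _)).
  have h2 : a * `|y - x| <= a * (a * (T - 1) * `|S x|) by rewrite ler_wpM2l.
  have h3 : 0 <= a * (a * `|S x|) by rewrite mulr_ge0.
  by move: IHe; nra.
Qed.

Lemma ccu_epoch_error x (s : 'S_m) :
  `|ccu_epoch S a s x - (x - a *: S x)| <= 3 ^+ m * a ^+ 2 * `|S x|.
Proof.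
have [_] := coord_sweep_error x [seq s j | j <- enum 'I_m].
rewrite size_map size_enum_ord big_map big_enum /=.
rewrite -(reindex_inj (@perm_inj _ s) (P := predT)
  (F := fun i => block i (S x))).
by rewrite sum_block [_ * 3 ^+ m]mulrC.
Qed.

End epoch_error.

(** * The step sizes *)

(** The series of the [k^(-3/2)] is compared with a telescoping one:
[k^(-3/2) <= 2 ((k - 1)^(-1/2) - k^(-1/2))] for [k >= 2]. *)
Lemma cvg_series_riemann_half3 (R : realType) :
  cvgn (series (fun k => (@riemannR R (1 / 2) k) ^+ 3)).
Proof.
pose a := @riemannR R (1 / 2).
have half0 : (0 : R) <= 1 / 2 by lra.
have a0 k : 0 < a k by exact: riemannR_gt0.
have a2 k : (a k ^+ 2)^-1 = k.+1%:R.
  rewrite /a /riemannR exprVn invrK -powR_mulrn ?powR_ge0// -powRrM.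
  by rewrite mul1r mulVf// powRr1.
have step k : a k.+1 ^+ 3 <= 2 * (a k - a k.+1).
  have : (a k.+1 ^+ 2)^-1 = (a k ^+ 2)^-1 + 1 by rewrite !a2 -natr1.
  have p0 := a0 k; have q0 := a0 k.+1; move: (a k) (a k.+1) p0 q0 => p q p0 q0.
  move=> pq; have {}pq : p ^+ 2 - q ^+ 2 = p ^+ 2 * q ^+ 2.
    have -> : p ^+ 2 - q ^+ 2 = p ^+ 2 * q ^+ 2 * ((q ^+ 2)^-1 - (p ^+ 2)^-1).
      by field; rewrite !gt_eqF.
    by rewrite pq addrC addKr mulr1.
  have qp : q <= p.
    rewrite -(@ler_pXn2r _ 2)// ?nnegrE ?(ltW p0) ?(ltW q0)// -subr_ge0 pq.
    by rewrite mulr_ge0 ?sqr_ge0.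
  have h : p * q ^+ 2 <= 2 * (p - q).
    rewrite -(ler_pM2l p0).
    have -> : p * (p * q ^+ 2) = (p - q) * (p + q).
      by rewrite -subr_sqr pq; ring.
    by nra.
  apply: le_trans h; rewrite exprS; apply: ler_wpM2r => //; exact: sqr_ge0.
apply: (@cvg_series_ge0 _ _ 3); first by move=> k; rewrite exprn_ge0// ltW.
have a_0 : a 0%N = 1 by rewrite /a /riemannR powR1 invr1.
case=> [|n]; first by rewrite /series/= big_geq.
suff : series (fun k => a k ^+ 3) n.+1 <= 3 - 2 * a n by have := a0 n; lra.
elim: n => [|n IH]; first by rewrite seriesSr /series/= big_geq// a_0; lra.
by rewrite seriesSr; have := step n; move: IH => /=; lra.
Qed.

(** * Convergence of cyclic coordinate updates *)

Theorem theorem3p4 (R : realType) (m : nat) (H : 'I_m -> hilbertType R)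
    (S : hprod H -> hprod H) (s : nat -> 'S_m) (x : nat -> hprod H) :
  nonexpansive (fun z => z - S z) ->
  zer S !=set0 ->
  ccu_sequence S (fun k => 1 / k%:R `^ (1 / 2)) s x ->
  exists2 xstar, zer S xstar & weakly_cvg x xstar.
Proof.
move=> S_ne Sz ccu.
pose a := @riemannR R (1 / 2).
have half0 : (0 : R) <= 1 / 2 by lra.
have a0 k : 0 < a k by exact: riemannR_gt0.
have a1 k : a k <= 1.
  rewrite /a /riemannR invf_le1 ?powR_gt0//.
  by rewrite -[leLHS](powRr0 k.+1%:R) ler_powR// ler1n.
pose e k := ccu_epoch S (a k) (s k.+1) (x k) - (x k - a k *: S (x k)).
apply: (@inexact_krasnoselskii_mann R _ S (3 ^+ m) a x e) => //.
- by apply: dvg_riemannR; lra.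
- exact: cvg_series_riemann_half3.
- by move=> k; rewrite ccu// div1r /e addrC subrK.
- by move=> k; apply: ccu_epoch_error => //; exact: ltW.
Qed.
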